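(* Let $G$ be a finite $2$-group and let $n$ be a non-negative integer such that $|G'| > 2^{n(n-1)/2}$. Then there do not exist two proper subgroups $H_1, H_2$ of $G$, at least one of which has index at least $4$ in $G$, such that every element $x \in G$ with $b(x) \geq n$ lies in $H_1 \cup H_2$.
   Context: $G'$ denotes the derived subgroup of $G$. For $x$ in a finite $2$-group $G$, the breadth $b(x)$ is defined by $|G : C_G(x)| = 2^{b(x)}$, where $C_G(x)$ is the centralizer of $x$ in $G$. *)

(* Defs.v *)
From mathcomp Require Import all_boot all_fingroup all_solvable.
Set Implicit Arguments. Unset Strict Implicit. Unset Printing Implicit Defensive.
Local Open Scope group_scope.

(* Breadth of x in the finite 2-group G: |G : C_G(x)| = 2 ^ breadth G x. *)
Definition breadth (gT : finGroupType) (G : {group gT}) (x : gT) : nat :=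
  logn 2 #|G : 'C_G[x]|.

(* Main.v *)
Require Import Defs.
From mathcomp Require Import all_boot all_fingroup all_solvable.
Local Open Scope group_scope.
Set Implicit Arguments.
Unset Strict Implicit.

(** Argue by induction on the order of [G]. Let [M] have index 2 in [G],
    let [x] lie outside [M], and let [L] be the subgroup of all [g] in [M] with
    [[g, x]] in [M'].  Then [|G'| <= |M'| |M : L|], the index [|M : L|] is at most
    [2 ^ b(x)], and every [y] in [M] outside [L] has breadth one less in [M]
    than in [G], because [C_G(y)] is contained in [M].

    Suppose that all elements outside [H1] and [H2] have breadth less than [n].
    Enlarge [H1] to a maximal subgroup [N] and choose [M] so that its elements
    outside [N] avoid [H2], and [x] outside [M], [N] and [H2].  When [|M : L| >= 4] or
    [L <= N], induction applies to [M] with the pair [(N, L)] and [n - 1].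
    When [|M : L| = 1], it applies to [M] with [n].  In the remaining case [L] and
    [M :&: N] are distinct of index 2 in [M]; the third such subgroup [J]
    containing their intersection has its elements outside [N] also outside
    [L], so the same argument inside [M], with [J] in place of [M], concludes. *)

(** * Pairs of proper subgroups and subgroups of index 2 *)

Lemma not_cover2 (gT : finGroupType) (G H K : {group gT}) :
  ~~ (G \subset H) -> ~~ (G \subset K) ->
  exists2 x, x \in G & (x \notin H) && (x \notin K).
Proof.
case/subsetPn=> h Gh nHh /subsetPn[k Gk nKk].
have [Kh|nKh] := boolP (h \in K); last by exists h; rewrite ?nHh.
have [Hk|nHk] := boolP (k \in H); last by exists k; rewrite ?nHk.
exists (h * k); first by rewrite groupM.
by rewrite groupMr // nHh groupMl.
Qed.

(** For [y] outside [H], the coset [y *: H] lies in the complement of [H], and index 2 means that it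
    fills it. The elementwise form makes it easy to recognise new subgroups of index 2. *)
Lemma index2P (gT : finGroupType) (G H : {group gT}) : H \subset G ->
  #|G : H| = 2 <->
  ~~ (G \subset H) /\
  {in G &, forall x y, x \notin H -> y \notin H -> x * y \in H}.
Proof.
move=> sHG; have coset_out y : y \in G -> y \notin H -> y *: H \subset G :\: H.
  move=> Gy nHy; apply/subsetP=> _ /lcosetP[h Hh ->].
  by rewrite inE groupMr // nHy groupM // (subsetP sHG).
have cardG := cardsID H G; rewrite (setIidPr sHG) in cardG.
split=> [iHG | [nsGH mulH]].
  split=> [|x y Gx Gy nHx nHy]; first by rewrite -indexg_eq1 iHG.
  have: x^-1 \in y *: H.
    suff ->: y *: H = G :\: H by rewrite inE !groupV nHx.
    apply/eqP; rewrite eqEcard coset_out // card_lcoset.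
    by rewrite -(leq_add2l #|H|) cardG -(Lagrange sHG) iHG muln2 addnn leqnn.
  by rewrite mem_lcoset -invMg groupV.
have [y Gy nHy] := subsetPn nsGH.
suff defD : G :\: H = y *: H.
  by rewrite -divgS // -cardG defD card_lcoset addnn -mul2n mulnK.
apply/eqP; rewrite eqEsubset coset_out // andbT.
apply/subsetP=> x /setDP[Gx nHx].
by rewrite mem_lcoset mulH ?groupV.
Qed.

Lemma third_index2 (gT : finGroupType) (G H K : {group gT}) :
  H \subset G -> #|G : H| = 2 -> K \subset G -> #|G : K| = 2 ->
  ~~ (K \subset H) ->
  exists M : {group gT},
    [/\ M \subset G, #|G : M| = 2, ~~ (M \subset H) & M :&: K \subset H].
Proof.
move=> sHG /(index2P sHG)[nsGH mulH] sKG /(index2P sKG)[nsGK mulK] nsKH.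
(* Membership in [H] and in [K] gives two characters of [G] with values of order 2; [A] is the
   kernel of their product. *)
pose A := [set x in G | (x \in H) == (x \in K)].
have mulA x y : x \in G -> y \in G ->
    (x * y \in A) = ((x \in A) == (y \in A)).
  move=> Gx Gy; have mulE (L : {group gT}) :
    {in G &, forall x y, x \notin L -> y \notin L -> x * y \in L} ->
    (x * y \in L) = ((x \in L) == (y \in L)).
    move=> mulL; have [Lx|nLx] := boolP (x \in L); first
      by rewrite groupMl // eq_sym eqb_id.
    by have [Ly|nLy] := boolP (y \in L); [rewrite groupMr ?(negPf nLx) | rewrite mulL].
  rewrite !inE groupM // Gx Gy !mulE //=.
  by case: (x \in H) (y \in H) (x \in K) (y \in K) => [] [] [] [].
have gA : group_set A.
  apply/group_setP; split=> [|x y Ax Ay]; first by rewrite inE !group1.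
  have [Gx Gy] : x \in G /\ y \in G by move: Ax Ay; rewrite !inE => /andP[-> _] /andP[].
  by rewrite mulA // Ax Ay.
have sAG : A \subset G by apply/subsetP=> x; rewrite inE => /andP[].
exists (Group gA); split=> //.
- apply/(@index2P _ _ (Group gA)) => //; split.
    have [k Kk nHk] := subsetPn nsKH; apply/subsetPn; exists k;
      rewrite ?(subsetP sKG) //=.
    by rewrite inE Kk (negPf nHk) andbF.
  by move=> x y Gx Gy /= /negPf nAx /negPf nAy; rewrite mulA // nAx nAy.
- have [x Gx /andP[nHx nKx]] := not_cover2 nsGH nsGK.
  by apply/subsetPn; exists x; rewrite //= inE Gx (negPf nHx) (negPf nKx).
by apply/subsetP=> x; rewrite !inE => /andP[/andP[_ /eqP->]].
Qed.

(** * Derived subgroups and classes across an index 2 subgroup *)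

(** As [M] is abelian, [g |-> [~ g, x]] is an endomorphism of [M]. Its image [I] is normalized by
    [M] and [x], which commute modulo [I], so [I] contains the derived subgroup. *)
Lemma card_der1_abelian_cyclic_ext (gT : finGroupType) (G M : {group gT}) (x : gT) :
  M <| G -> abelian M -> x \in G -> G \subset M <*> <[x]> ->
  (#|G^`(1)| <= #|x ^: M|)%N.
Proof.
move=> nMG cMM Gx sGMx; have [sMG nMG'] := andP nMG.
have nMx : x \in 'N(M) by rewrite (subsetP nMG').
pose I := [set [~ g, x] | g in M].
have sIM : I \subset M.
  apply/subsetP=> _ /imsetP[g Mg ->]; rewrite commgEl groupM ?groupV ?memJ_norm //.
have cM : {in M &, forall g h, g ^ h = g}.
  by move=> g h Mg Mh; apply/conjg_fixP/commgP/(centsP cMM).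
have gI : group_set I.
  apply/group_setP; split=> [|_ _ /imsetP[g Mg ->] /imsetP[h Mh ->]].
    by apply/imsetP; exists 1; rewrite ?group1 ?comm1g.
  apply/imsetP; exists (g * h); rewrite ?groupM // commMgJ cM //.
  by apply: (subsetP sIM); apply/imsetP; exists g.
have nIG : M <*> <[x]> \subset 'N(Group gI).
  rewrite join_subG cycle_subG; apply/andP; split.
    by apply: subset_trans (sub_abelian_norm cMM sIM).
  rewrite inE; apply/subsetP=> _ /imsetP[_ /imsetP[g Mg ->] ->].
  apply/imsetP; exists (g ^ x); rewrite ?memJ_norm //.
  by rewrite conjRg (conjgE x x) mulKg.
have sder : G^`(1) \subset Group gI.
  apply: der1_min; first exact: subset_trans nIG.
  apply: abelianS (quotientS _ sGMx) _.
  have [nIM nIx] : M \subset 'N(Group gI) /\ x \in 'N(Group gI).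
    by move: nIG; rewrite join_subG cycle_subG => /andP.
  rewrite quotientY ?cycle_subG // abelianY !quotient_abelian ?cycle_abelian //.
  rewrite centsC quotient_cycle // cent_cycle.
  apply/subsetP=> _ /morphimP[g nIg Mg ->]; apply/cent1P/commgP.
  by rewrite -morphR //= coset_id //; apply/imsetP; exists g.
apply: leq_trans (subset_leq_card sder) _ => /=.
(* Since [x^-1 * x ^ g] is the inverse of [[~ g, x]], translation and inversion match [x ^: M] with
   [I]. *)
have eI : [set x^-1 * y | y in (x ^: M)] = [set y^-1 | y in I].
  rewrite /class -!imset_comp; apply: eq_in_imset => g _ /=.
  by rewrite invg_comm commgEl.
by rewrite -(card_imset (mem I) (@invg_inj gT)) -eI card_imset //; exact: mulgI.
Qed.

(** The subgroup [L] of the overview, for [x] normalizing the derived subgroup of [M]; a preimage of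
    a centralizer is a group by construction. *)
Definition cent_mod_der (gT : finGroupType) (M : {group gT}) (x : gT) :=
  (M :&: coset M^`(1) @*^-1 'C[coset M^`(1) x])%G.

Section IndexTwo.

Variables (gT : finGroupType) (G M : {group gT}) (x : gT).
Hypotheses (sMG : M \subset G) (iMG : #|G : M| = 2) (Gx : x \in G) (nMx : x \notin M).

Let L := cent_mod_der M x.
Let nMG : M <| G := index2_normal sMG iMG.
Let nQG : M^`(1) <| G := char_normal_trans (der_char 1 M) nMG.
Let nQM : M \subset 'N(M^`(1)) := subset_trans sMG (normal_norm nQG).
Let nQx : x \in 'N(M^`(1)) := subsetP (normal_norm nQG) x Gx.

Lemma index_cent_mod_der : #|M : L| = #|coset M^`(1) x ^: (M / M^`(1))|.
Proof.
have sQL : M^`(1) \subset L.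
  by rewrite subsetI der_sub /= -{1}(ker_coset M^`(1)) morphpreS ?sub1G.
rewrite -index_cent1 -(index_quotient_eq _ _ nQM) ?subsetIl //.
  by rewrite quotientGI ?cosetpreK // der_sub.
by rewrite (setIidPr (der_sub 1 M)).
Qed.

Lemma index_cent_mod_der_le_class : (#|M : L| <= #|x ^: G|)%N.
Proof.
rewrite index_cent_mod_der -quotient_class //.
by apply: leq_trans (leq_morphim _ _) (subset_leq_card (classS _ sMG)).
Qed.

(** Modulo the derived subgroup of [M], the group [G] is an abelian group extended by [x], so the
    previous bound applies there. *)
Lemma card_der1_index2 : (#|G^`(1)| <= #|M^`(1)| * #|M : L|)%N.
Proof.
rewrite index_cent_mod_der.
have sQG' : M^`(1) \subset G^`(1) by rewrite dergS.
rewrite -(Lagrange sQG') leq_mul2l -card_quotient; last first.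
  by apply: subset_trans (der_sub 1 G) (normal_norm nQG).
rewrite quotient_der ?normal_norm // card_der1_abelian_cyclic_ext ?orbT //.
- exact: quotient_normal.
- exact: sub_der1_abelian.
- exact: mem_quotient.
rewrite -quotient_cycle // -quotientY ?cycle_subG // quotientS //.
apply/subsetP=> y Gy; have [_ mulM] := (index2P sMG).1 iMG.
have [My|nMy] := boolP (y \in M); first by rewrite mem_gen // inE My.
rewrite -(mulgKV x y) groupM // mem_gen // inE ?cycle_id ?orbT //.
by rewrite mulM ?groupV.
Qed.

Lemma card_class_index2 y : y \in M -> y \notin L -> (2 * #|y ^: M| <= #|y ^: G|)%N.
Proof.
move=> My nLy; rewrite -!index_cent1 -iMG.
suff sCM : 'C_G[y] \subset M.
  have -> : 'C_M[y] = 'C_G[y] by rewrite -{1}(setIidPl sMG) -setIA (setIidPr sCM).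
  by rewrite Lagrange_index ?subsetIl.
apply/subsetP=> g /setIP[Gg cyg]; apply: contraR nLy => nMg.
have Mh : g * x^-1 \in M by rewrite ((index2P sMG).1 iMG).2 ?groupV.
have nQy : y \in 'N(M^`(1)) by rewrite (subsetP nQM).
have nQh : g * x^-1 \in 'N(M^`(1)) by rewrite (subsetP nQM).
rewrite inE My mem_morphpre //=; apply/cent1P.
have -> : x = (g * x^-1)^-1 * g by rewrite invMg invgK mulgKV.
have nQg : g \in 'N(M^`(1)) by rewrite (subsetP (normal_norm nQG)).
rewrite morphM ?groupV // morphV //=; apply: commuteM.
  apply: commuteV; apply: (centsP (sub_der1_abelian (subxx _))); exact: mem_quotient.
by rewrite /commute -!morphM //= (cent1P cyg).
Qed.

End IndexTwo.

(** * The induction on the order of the group *)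

(** Allowing [H2 \subset H1] covers the case of a single excluded subgroup, which the induction
    itself produces. *)
Lemma card_der1_leq_off2 (gT : finGroupType) (n : nat) (G H1 H2 : {group gT}) :
    2.-group G -> H1 \proper G -> H2 \proper G ->
    (H2 \subset H1) || (4 <= #|G : H2|)%N ->
    {in G, forall x, x \notin H1 -> x \notin H2 -> #|x ^: G| < 2 ^ n}%N ->
  (#|G^`(1)| <= 2 ^ 'C(n, 2))%N.
Proof.
have [k] := ubnP #|G|; elim: k => // k IHk in n G H1 H2 *; rewrite ltnS => leGk.
move=> pG prH1 prH2 H2small smallG.
have [eH1|[N maxN sH1N]] := maximal_exists (proper_sub prH1).
  by rewrite eH1 properxx in prH1.
have [prN _] := maxgroupP maxN; have [sNG nsGN] := andP prN.
have iN := p_maximal_index pG maxN.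
have {}H2small : (H2 \subset N) || (4 <= #|G : H2|)%N.
  by case/orP: H2small => [/subset_trans-> //|->]; rewrite ?orbT.
have {}smallG x : x \in G -> x \notin N -> x \notin H2 -> (#|x ^: G| < 2 ^ n)%N.
  by move=> Gx nNx; apply: smallG; rewrite // (contra (subsetP sH1N x)).
have {IHk leGk H1 prH1 sH1N maxN}
  IH i (S T : {group gT}) : S \proper G -> ~~ (S \subset N) -> T \proper S ->
    (T \subset N) || (4 <= #|S : T|)%N ->
    {in S, forall y, y \notin N -> y \notin T -> #|y ^: S| < 2 ^ i}%N ->
  (#|S^`(1)| <= 2 ^ 'C(i, 2))%N.
- move=> prS nsSN prT Tsmall smallS.
  apply: (IHk i S (S :&: N)%G T) => //.
  + exact: leq_trans (proper_card prS) leGk.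
  + exact: pgroupS (proper_sub prS) pG.
  + by rewrite properE subsetIl subsetI subxx.
  + by rewrite subsetI (proper_sub prT).
  by move=> y Sy; rewrite inE Sy; apply: smallS.
have IH1 i (S : {group gT}) : S \proper G -> ~~ (S \subset N) ->
    {in S, forall y, y \notin N -> #|y ^: S| < 2 ^ i}%N ->
  (#|S^`(1)| <= 2 ^ 'C(i, 2))%N.
- move=> prS nsSN smallS; apply: (IH i S (S :&: N)%G) => //.
  + by rewrite properE subsetIl subsetI subxx.
  + by rewrite subsetIr.
  by move=> y Sy nNy _; apply: smallS.
have ind2 (S T : {group gT}) : S \subset G -> T \subset S ->
    exists c, #|S : T| = (2 ^ c)%N.
  move=> sSG sTS; suff /p_natP[c ->] : 2.-nat #|S : T| by exists c.
  exact: pnat_dvd (dvdn_indexg _ _) (pgroupS sSG pG).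
(* [K] is taken above [H2], or, if [H2] lies in [N], above some [g] outside [N]; no such maximal
   subgroup exists only if [g] generates [G]. *)
have [cGG | [K maxK [nsKN H2K]]] : abelian G \/
    exists2 K : {group gT}, maximal K G &
      ~~ (K \subset N) /\ (H2 \subset N) || (H2 \subset K).
- have [sH2N | nsH2N] := boolP (H2 \subset N).
    have [g Gg nNg] := subsetPn nsGN.
    have sgG : <[g]> \subset G by rewrite cycle_subG.
    have [<-|[K maxK sgK]] := maximal_exists sgG; first by left; apply: cycle_abelian.
    right; exists K => //; split=> //; apply: contra nNg => /subsetP-> //.
    by rewrite -cycle_subG.
  have [eH2|[K maxK sH2K]] := maximal_exists (proper_sub prH2).
    by rewrite eH2 properxx in prH2.
  by right; exists K => //; rewrite sH2K (contra (subset_trans sH2K)).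
- by rewrite derg1 (commG1P cGG) cards1 expn_gt0.
have [prK _] := maxgroupP maxK; have iK := p_maximal_index pG maxK.
have [M [sMG iM nsMN sMKN]] := third_index2 sNG iN (proper_sub prK) iK nsKN.
have prM : M \proper G by rewrite properE sMG -indexg_eq1 iM.
have smallM y : y \in M -> y \notin N -> (#|y ^: G| < 2 ^ n)%N.
  move=> My nNy; apply: smallG; rewrite ?(subsetP sMG) //.
  apply: contra nNy => H2y; case/orP: H2K => [/subsetP-> // | /subsetP sH2K].
  by rewrite (subsetP sMKN) // inE My sH2K.
(* When [H2] is not in [N], its index of at least 4 keeps it from being all of [K]. *)
have [x Kx /andP[nNx nH2x]] : exists2 x, x \in K & (x \notin N) && (x \notin H2).
  have [sH2N | nsH2N] := boolP (H2 \subset N).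
    have [x Kx nNx] := subsetPn nsKN; exists x; rewrite // nNx.
    by rewrite (contra (subsetP sH2N x)).
  apply: not_cover2 nsKN _; apply/negP=> sKH2.
  move: H2small; rewrite (negPf nsH2N) /= leqNgt => /negP[].
  have sH2K : H2 \subset K by rewrite (negPf nsH2N) in H2K.
  suff -> : #|G : H2| = #|G : K| by rewrite iK.
  by congr #|_ : _|; apply/eqP; rewrite eqEsubset sH2K.
have Gx : x \in G by rewrite (subsetP (proper_sub prK)).
have nMx : x \notin M.
  by apply: contra nNx => Mx; rewrite (subsetP sMKN) // inE Mx.
pose L := cent_mod_der M x.
have sLM : L \subset M by apply: subsetIl.
have [c iL] := ind2 M L sMG sLM.
have ltcn : (c < n)%N.
  rewrite -(ltn_exp2l _ _ (ltnSn 1)) -iL.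
  apply: leq_ltn_trans (index_cent_mod_der_le_class sMG iM Gx) _.
  exact: smallG.
have := card_der1_index2 sMG iM Gx nMx; rewrite -/L iL => /leq_trans-> //.
(* From here [n] is one less than the original bound, so that [c <= n]. *)
case: n => // n in smallG smallM ltcn *.
have smallML y : y \in M -> y \notin N -> y \notin L -> (#|y ^: M| < 2 ^ n)%N.
  move=> My nNy nLy; have := smallM y My nNy; rewrite expnS => ltyn.
  rewrite -(ltn_pmul2l (ltn0Sn 1)).
  exact: leq_ltn_trans (card_class_index2 sMG iM Gx nMx My nLy) ltyn.
case: c => [|c] in iL ltcn *.
  rewrite muln1; apply: IH1 => // y My nNy; apply: leq_ltn_trans (smallM y My nNy).
  by rewrite subset_leq_card ?classS.
have prL : L \proper M by rewrite properE sLM -indexg_eq1 iL -(expn0 2) eqn_exp2l.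
rewrite binS bin1 expnD.
have [Lsmall | ] := boolP ((L \subset N) || (4 <= #|M : L|)%N).
  rewrite leq_mul ?leq_exp2l //; apply: (IH n M L) => // y; exact: smallML.
rewrite negb_or -ltnNge iL (ltn_exp2l _ 2) // !ltnS leqn0 => /andP[nsLN /eqP c0].
rewrite {c}c0 in iL ltcn *.
have iMN : #|M : M :&: N| = 2.
  apply/(@index2P _ _ (M :&: N)%G); first exact: subsetIl.
  rewrite subsetI subxx; split=> // y z My Mz; rewrite !inE My Mz groupM //=.
  by apply: ((index2P sNG).1 iN).2; apply: (subsetP sMG).
have nsLMN : ~~ (L \subset M :&: N) by rewrite subsetI sLM.
have [J [sJM iJ nsJMN sJLN]] := third_index2 (subsetIl M N) iMN sLM iL nsLMN.
have nsJN : ~~ (J \subset N) by rewrite subsetI sJM in nsJMN.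
have prJ : J \proper G := sub_proper_trans sJM prM.
have [u Lu nNu] := subsetPn nsLN.
have Mu := subsetP sLM u Lu.
have nJu : u \notin J.
  apply: contra nNu => Ju; have /setIP[] // : u \in M :&: N.
  by rewrite (subsetP sJLN) // inE Ju.
have smallJ y : y \in J -> y \notin N -> (#|y ^: M| < 2 ^ n)%N.
  move=> Jy nNy; have My := subsetP sJM y Jy; apply: smallML => //.
  apply: contra nNy => Ly; have /setIP[] // : y \in M :&: N.
  by rewrite (subsetP sJLN) // inE Jy.
(* The triple [M], [J], [u] repeats [G], [M], [x]. As [u] is in [L], only its class in [G] is
   bounded, which leaves [d = n] possible. *)
pose P := cent_mod_der J u.
have sPJ : P \subset J by apply: subsetIl.
have [d iP] := ind2 J P (proper_sub prJ) sPJ.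
have ledn : (d <= n)%N.
  rewrite -ltnS -(ltn_exp2l _ _ (ltnSn 1)) -iP.
  apply: leq_ltn_trans (index_cent_mod_der_le_class sJM iJ Mu) _.
  apply: leq_ltn_trans (smallM u Mu nNu).
  by rewrite subset_leq_card ?classS.
rewrite -expnD; have := card_der1_index2 sJM iJ Mu nJu; rewrite -/P iP => leM'.
apply: leq_trans (leq_mul leM' (leqnn _)) _; rewrite -mulnA -expnD addn1.
have [ltdn | ] := ltnP d n.
  rewrite expnD leq_mul ?leq_exp2l //; apply: IH1 => // y Jy nNy.
  apply: leq_ltn_trans (smallJ y Jy nNy).
  by rewrite subset_leq_card ?classS.
move=> lend; have {ledn lend} dn : d = n by apply/eqP; rewrite eqn_leq ledn.
(* In this extreme case [P] has large index in [J], and the elements of [J] outside [N] and [P] lose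
   one more factor 2 in class size. *)
rewrite {d leM'}dn in iP *; case: n => // n in {smallG smallM smallML} smallJ ltcn iP *.
have prP : P \proper J by rewrite properE sPJ -indexg_eq1 iP -(expn0 2) eqn_exp2l.
have smallJP y : y \in J -> y \notin N -> y \notin P -> (#|y ^: J| < 2 ^ n)%N.
  move=> Jy nNy nPy; have := smallJ y Jy nNy; rewrite expnS => ltyn.
  rewrite -(ltn_pmul2l (ltn0Sn 1)).
  exact: leq_ltn_trans (card_class_index2 sJM iJ Mu nJu Jy nPy) ltyn.
(* For [n = 0] some class would be empty. Otherwise the index of [P] is [2 ^ n.+2], at least 4, and
   the pair [N], [P] is admissible for [J]. *)
case: n => [|n] in {smallJ ltcn} smallJP iP *.
  have [y Jy /andP[nNy nPy]] := not_cover2 nsJN (proper_subn prP).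
  have := smallJP y Jy nNy nPy; rewrite ltnS leqn0 cards_eq0 => /eqP y0.
  by have := class_refl J y; rewrite y0 inE.
have leJ' : (#|J^`(1)| <= 2 ^ 'C(n.+1, 2))%N.
  apply: (IH n.+1 J P) => //; first by rewrite iP -[4]/(2 ^ 2)%N leq_exp2l ?orbT.
apply: leq_trans (leq_mul leJ' (leqnn _)) _.
by rewrite -expnD leq_exp2l // (binS n.+1) bin1 -addnA leq_add2l !addnS addSn !ltnS leq_addl.
Qed.

Theorem theorem1p3 (gT : finGroupType) (G : {group gT}) (n : nat) :
  2.-group G ->
  (2 ^ (n * (n - 1) %/ 2) < #|G^`(1)|)%N ->
  ~ (exists H1 H2 : {group gT},
        [/\ H1 \proper G, H2 \proper G,
            (4 <= #|G : H1|)%N || (4 <= #|G : H2|)%N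
          & forall x, x \in G -> (n <= breadth G x)%N -> x \in H1 :|: H2]).
Proof.
move=> pG; rewrite divn2 subn1 -bin2 ltnNge => /negP ltG'.
case=> H1 [H2 [prH1 prH2 small_ind wideG]]; apply: ltG'.
have smallG x : x \in G -> x \notin H1 -> x \notin H2 -> (#|x ^: G| < 2 ^ n)%N.
  move=> Gx nH1x nH2x; have : (breadth G x < n)%N.
    rewrite ltnNge; apply/negP=> /(wideG x Gx).
    by rewrite inE (negPf nH1x) (negPf nH2x).
  rewrite /breadth index_cent1; have /p_natP[b ->] : 2.-nat #|x ^: G|.
    by rewrite -index_cent1; apply: pnat_dvd (dvdn_indexg _ _) pG.
  by rewrite pfactorK // ltn_exp2l.
(* The lemma puts the index condition on its second subgroup, so the two are swapped if [H1] is the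
   small one. *)
case/orP: small_ind => small_ind; last first.
  by apply: (@card_der1_leq_off2 _ n G H1 H2); rewrite ?small_ind ?orbT.
apply: (@card_der1_leq_off2 _ n G H2 H1); rewrite ?small_ind ?orbT //.
by move=> x Gx nH2x nH1x; apply: smallG.
Qed.
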